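(* Let $d = 2$. For all values $x, y \in [0,1]$, the quantity $$W_2 = W_2(x,y) = \sup_{f \in C([0,1]^2),\ f \neq \mathrm{const}}\ \ \sup_{n_1, n_2 = 1,2,\ldots}\ \left[\frac{\Delta_{n_1,n_2}[f](x,y)}{J_{n_1,n_2}[f](x,y)}\right]$$ satisfies $$\frac{1}{\pi} \le W_2(x,y) \le 2^d .$$
   Context: $C([0,1]^2)$ is the set of continuous real-valued functions on $[0,1]^2$. For $f \in C([0,1]^2)$ and positive integers $n_1,n_2$, the bivariate Bernstein polynomial is $$B_{n_1,n_2}[f](x,y) = \sum_{k_1=0}^{n_1}\sum_{k_2=0}^{n_2} \binom{n_1}{k_1}\binom{n_2}{k_2} f\left(\frac{k_1}{n_1},\frac{k_2}{n_2}\right) x^{k_1}(1-x)^{n_1-k_1} y^{k_2}(1-y)^{n_2-k_2},$$ and the non-uniform error is $\Delta_{n_1,n_2}[f](x,y) = |B_{n_1,n_2}[f](x,y) - f(x,y)|$. The modulus of continuity is $$\omega[f](\delta_1,\delta_2) = \sup\{|f(x_1,y_1)-f(x_2,y_2)| : (x_1,y_1),(x_2,y_2)\in[0,1]^2,\ |x_1-x_2|\le\delta_1,\ |y_1-y_2|\le\delta_2\}, \quad \delta_1,\delta_2\ge 0.$$ With $\theta(p) = \sqrt{p(1-p)}$, $$J_{n_1,n_2}[f](x,y) = \int_0^\infty\int_0^\infty \omega[f]\left(\frac{z_1\theta(x)}{\sqrt{n_1}},\frac{z_2\theta(y)}{\sqrt{n_2}}\right) z_1 z_2 \exp\left(-\frac{z_1^2}{2}-\frac{z_2^2}{2}\right)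 dz_1\, dz_2 .$$ The first supremum is over all non-constant $f\in C([0,1]^2)$.
   Formalization: The lower bound 1/π is stated for all (x,y) in [0,1]^2 except the four vertices, where Δ and J vanish for every f, n_1, n_2, so each quotient is 0/0 and W_2 is undefined; elsewhere, 0/0 quotients count as 0. *)

(* Defs.v *)
From HB Require Import structures.
From mathcomp Require Import all_boot all_order all_algebra.
From mathcomp Require Import all_classical all_reals all_analysis.

Set Implicit Arguments.
Unset Strict Implicit.
Unset Printing Implicit Defensive.

Import Order.TTheory GRing.Theory Num.Theory.
Import numFieldNormedType.Exports.

Local Open Scope classical_set_scope.
Local Open Scope ring_scope.

Definition unit_square (R : realType) : set (R * R) := `[0, 1] `*` `[0, 1].
Arguments unit_square {R}.

(* Elements of C([0,1]^2) are represented by total functions on R * R; all the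
   quantities below depend only on the restriction to the unit square. *)
Definition continuous_on_square (R : realType) (f : R * R -> R) : Prop :=
  {within unit_square, continuous f}.

Definition constant_on_square (R : realType) (f : R * R -> R) : Prop :=
  exists c : R, forall p, unit_square p -> f p = c.

Definition bernstein2 (R : realType) (n1 n2 : nat) (f : R * R -> R)
    (x y : R) : R :=
  \sum_(k1 < n1.+1) \sum_(k2 < n2.+1)
    'C(n1, k1)%:R * 'C(n2, k2)%:R * f (k1%:R / n1%:R, k2%:R / n2%:R) *
    x ^+ k1 * (1 - x) ^+ (n1 - k1) * y ^+ k2 * (1 - y) ^+ (n2 - k2).

Definition Delta (R : realType) (n1 n2 : nat) (f : R * R -> R) (x y : R) : R :=
  `|bernstein2 n1 n2 f x y - f (x, y)|.

(* For d1, d2 >= 0 and f continuous on the square, the set is nonempty and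
   bounded, so that sup is the actual supremum. *)
Definition modulus (R : realType) (f : R * R -> R) (d1 d2 : R) : R :=
  sup [set r | exists p q : R * R,
    [/\ unit_square p, unit_square q, `|p.1 - q.1| <= d1,
        `|p.2 - q.2| <= d2 & r = `|f p - f q|] ].

Definition theta (R : realType) (p : R) : R := Num.sqrt (p * (1 - p)).

Definition J (R : realType) (n1 n2 : nat) (f : R * R -> R) (x y : R) : \bar R :=
  (\int[lebesgue_measure]_(z2 in `[0%R, +oo[)
   \int[lebesgue_measure]_(z1 in `[0%R, +oo[)
     (modulus f (z1 * theta x / Num.sqrt n1%:R) (z2 * theta y / Num.sqrt n2%:R)
      * z1 * z2 * expR (- (z1 ^+ 2 / 2) - z2 ^+ 2 / 2))%:E)%E.

(* Division in \bar R: a / 0 = +oo for a > 0 and 0 / 0 = 0, so a pair with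
   J = 0 and Delta > 0 would make the supremum infinite, while an indeterminate
   quotient 0 / 0 does not contribute to it. *)
Definition W2 (R : realType) (x y : R) : \bar R :=
  ereal_sup
    [set ereal_sup [set ((Delta n.1 n.2 f x y)%:E / J n.1 n.2 f x y)%E
                   | n in [set n : nat * nat | (0 < n.1)%N /\ (0 < n.2)%N] ]
    | f in [set f : R * R -> R |
             continuous_on_square f /\ ~ constant_on_square f] ].

(* At the four vertices theta x = theta y = 0, hence Delta = J = 0 for all f,
   n1, n2: every quotient in W2 is 0 / 0 there. *)
Definition square_vertex (R : realType) (x y : R) : Prop :=
  (x = 0 \/ x = 1) /\ (y = 0 \/ y = 1).

(* Main.v *)
Require Import Defs.
From HB Require Import structures.
From mathcomp Require Import all_boot all_order all_algebra.
From mathcomp Require Import all_classical all_reals all_analysis measurable_realfun.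
From mathcomp Require Import ring lra.

Import Order.TTheory GRing.Theory Num.Theory.
Import numFieldNormedType.Exports.

Local Open Scope classical_set_scope.
Local Open Scope ring_scope.

(** Both bounds come from reading the Bernstein polynomial as an expectation:
    if S1, S2 are independent binomial variables with parameters (n1, x) and
    (n2, y), then B f (x, y) is the mean of f (S1 / n1, S2 / n2), and the
    coordinates of this random point have means x, y and standard deviations
    d1 = theta x / sqrt n1 and d2 = theta y / sqrt n2.

    Upper bound.  Splitting a segment into m equal pieces shows that the
    modulus omega satisfies |f p - f q| <= m omega(e1, e2) as soon as
    |p.i - q.i| <= m e_i.  The number of pieces of size c d1, c d2 needed to
    join (x, y) to the random point is at most 1 + t, with t the integer part
    of its distance in units of c d1, c d2.  An affine function of t^2 that
    dominates 1 + t at every natural number (lemma [stair_bound_ge]) turns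
    this into a second-moment estimate, and the second moments are exactly
    d1^2 and d2^2: this is [Delta_le_modulus], which gives
    Delta <= (7/3) omega(d1, d2) and Delta <= (19/5) omega(d1/2, d2/2).  On
    the other side omega is nondecreasing, so J is at least the integral of
    the two-step function with the corresponding values, on the quadrants
    z1, z2 >= 1/2 and z1, z2 >= 1.  The density z exp(-z^2/2) has tail
    exp(-c^2/2), hence J >= Delta (5/19 e^(-1/4) + 22/133 e^(-1)), and the
    bracket exceeds 1/4.

    Lower bound.  Take f(u, v) = |u - x| + |v - y|.  Its modulus is at most
    e1 + e2, so that J is at most d1 + d2 times the integral of
    z^2 exp(-z^2/2), which is at most sqrt 2 <= pi / 2.
    Its error is the sum of the mean absolute deviations of S1 / n1 and
    S2 / n2.  The fourth central moment of a
    binomial law of variance s^2 >= 1 is at most 4 s^4, which forces the mean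
    absolute deviation to be at least s / 2; this applies to any large enough
    degree.  So Delta >= (d1 + d2) / 2 >= J / pi, and d1 + d2 > 0 away from
    the vertices. *)

(** * Moments of the binomial law *)

Section Binomial.
Context {R : realType}.
Implicit Types (x c : R) (phi psi : nat -> R).

Definition bin_weight n x k : R := 'C(n, k)%:R * x ^+ k * (1 - x) ^+ (n - k).
Definition bin_mean n x phi : R := \sum_(k < n.+1) bin_weight n x k * phi k.

Lemma bin_mean0 x phi : bin_mean 0 x phi = phi 0%N.
Proof. by rewrite /bin_mean big_ord1 /bin_weight bin0 !expr0 !mulr1 mul1r. Qed.

Lemma bin_weightS n x k : (k <= n)%N ->
  bin_weight n.+1 x k.+1 = x * bin_weight n x k + (1 - x) * bin_weight n x k.+1.
Proof.
rewrite leq_eqVlt /bin_weight binS natrD subSS => /predU1P[->|kn].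
  by rewrite bin_small// exprS; ring.
by rewrite -(subnSK kn) !exprS; ring.
Qed.

(** Conditioning on one of the n+1 Bernoulli trials; every moment formula below
    is an induction on n through this identity. *)
Lemma bin_meanS n x phi :
  bin_mean n.+1 x phi = x * bin_mean n x (phi \o succn) + (1 - x) * bin_mean n x phi.
Proof.
rewrite /bin_mean big_ord_recl /=.
under eq_bigr => i _ do
  rewrite /bump/= add1n bin_weightS ?leq_ord// mulrDl -!(mulrA _ (bin_weight _ _ _)).
rewrite big_split /= -!mulr_sumr addrCA; congr (_ + _).
have -> : \sum_(k < n.+1) bin_weight n x k * phi k
    = \sum_(k < n.+2) bin_weight n x k * phi k.
  by rewrite [RHS]big_ord_recr /= /bin_weight bin_small// !mul0r addr0.
rewrite [in RHS]big_ord_recl mulrDr; congr (_ + _).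
by rewrite /bin_weight !bin0 !subn0 exprS; ring.
Qed.

Lemma eq_bin_mean n x phi psi : phi =1 psi -> bin_mean n x phi = bin_mean n x psi.
Proof. by move=> e; apply: eq_bigr => k _; rewrite e. Qed.

Lemma bin_meanD n x phi psi :
  bin_mean n x (fun k => phi k + psi k) = bin_mean n x phi + bin_mean n x psi.
Proof. by rewrite -big_split; apply: eq_bigr => k _; rewrite mulrDr. Qed.

Lemma bin_meanZ n x c phi : bin_mean n x (fun k => c * phi k) = c * bin_mean n x phi.
Proof. by rewrite mulr_sumr; apply: eq_bigr => k _; rewrite mulrCA. Qed.

Lemma bin_weight_ge0 n x k : 0 <= x <= 1 -> 0 <= bin_weight n x k.
Proof.
by move=> /andP[x0 x1]; rewrite !mulr_ge0 ?exprn_ge0// subr_ge0.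
Qed.

(** Restricting the comparison to nodes of nonzero weight is what lets the edges
    of the square, where the law is a point mass, be treated with the rest. *)
Lemma le_bin_mean n x phi psi : 0 <= x <= 1 ->
  (forall k, (k <= n)%N -> bin_weight n x k != 0 -> phi k <= psi k) ->
  bin_mean n x phi <= bin_mean n x psi.
Proof.
move=> x01 le; apply: ler_sum => k _.
have [->|w0] := eqVneq (bin_weight n x k) 0; first by rewrite !mul0r.
by rewrite ler_wpM2l ?bin_weight_ge0// le// -ltnS.
Qed.

Lemma ler_norm_bin_mean n x phi : 0 <= x <= 1 ->
  `|bin_mean n x phi| <= bin_mean n x (fun k => `|phi k|).
Proof.
move=> x01; apply: le_trans (ler_norm_sum _ _ _) _; apply: ler_sum => k _.
by rewrite normrM (ger0_norm (bin_weight_ge0 _ _ _ x01)).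
Qed.

Lemma bin_mean1 n x : bin_mean n x (fun=> 1) = 1.
Proof.
elim: n => [|n IHn]; first by rewrite bin_mean0.
by rewrite bin_meanS (eq_bin_mean n x _ (fun=> 1))// IHn; ring.
Qed.

Lemma bin_mean_cst n x c : bin_mean n x (fun=> c) = c.
Proof.
by rewrite -{2}[c]mulr1 -(bin_mean1 n x) -bin_meanZ; apply: eq_bin_mean => k; rewrite mulr1.
Qed.

Definition dev n x k : R := k%:R - n%:R * x.

Lemma bin_mean_dev_rec n x (psi : R -> R) :
  bin_mean n.+1 x (psi \o dev n.+1 x)
  = x * bin_mean n x (fun k => psi (dev n x k + (1 - x)))
    + (1 - x) * bin_mean n x (fun k => psi (dev n x k - x)).
Proof.
rewrite bin_meanS; congr (_ * _ + _ * _); apply: eq_bin_mean => k /=; congr psi;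
  by rewrite /dev -!natr1; ring.
Qed.

(** The four moments are proved together because each step of the induction
    expands a power of a translate of the deviation, and so calls for all the
    lower ones. *)
Lemma bin_mean_dev_moments n x : let s := x * (1 - x) in
  [/\ bin_mean n x (dev n x) = 0,
      bin_mean n x (fun k => dev n x k ^+ 2) = n%:R * s,
      bin_mean n x (fun k => dev n x k ^+ 3) = n%:R * s * (1 - 2 * x) &
      bin_mean n x (fun k => dev n x k ^+ 4)
        = n%:R * s * (1 + (3 * n%:R - 6) * s)].
Proof.
move=> s; elim: n => [|n [M1 M2 M3 M4]].
  by rewrite !bin_mean0 /dev !mul0r subr0 !expr0n.
have lin (a0 a1 a2 a3 a4 : R) :
    bin_mean n x (fun k => a0 + a1 * dev n x k + a2 * dev n x k ^+ 2
      + a3 * dev n x k ^+ 3 + a4 * dev n x k ^+ 4)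
    = a0 + a2 * (n%:R * s) + a3 * (n%:R * s * (1 - 2 * x))
      + a4 * (n%:R * s * (1 + (3 * n%:R - 6) * s)).
  by rewrite !bin_meanD !bin_meanZ M1 M2 M3 M4 bin_mean_cst mulr0 addr0.
have step (psi : R -> R) (a0 a1 a2 a3 a4 b0 b1 b2 b3 b4 : R) :
    (forall t, psi (t + (1 - x))
       = a0 + a1 * t + a2 * t ^+ 2 + a3 * t ^+ 3 + a4 * t ^+ 4) ->
    (forall t, psi (t - x)
       = b0 + b1 * t + b2 * t ^+ 2 + b3 * t ^+ 3 + b4 * t ^+ 4) ->
    bin_mean n.+1 x (psi \o dev n.+1 x)
    = x * (a0 + a2 * (n%:R * s) + a3 * (n%:R * s * (1 - 2 * x))
           + a4 * (n%:R * s * (1 + (3 * n%:R - 6) * s)))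
      + (1 - x) * (b0 + b2 * (n%:R * s) + b3 * (n%:R * s * (1 - 2 * x))
           + b4 * (n%:R * s * (1 + (3 * n%:R - 6) * s))).
  move=> ha hb; rewrite bin_mean_dev_rec -(lin a0 a1) -(lin b0 b1).
  by congr (_ * _ + _ * _); apply: eq_bin_mean.
split.
- apply: etrans (step id (1 - x) 1 0 0 0 (- x) 1 0 0 0 _ _) _;
    [by move=> t; ring|by move=> t; ring|ring].
- apply: etrans (step (fun t => t ^+ 2) ((1 - x) ^+ 2) (2 * (1 - x)) 1 0 0
    (x ^+ 2) (- 2 * x) 1 0 0 _ _) _;
    [by move=> t; ring|by move=> t; ring|by rewrite -natr1 /s; ring].
- apply: etrans (step (fun t => t ^+ 3)
    ((1 - x) ^+ 3) (3 * (1 - x) ^+ 2) (3 * (1 - x)) 1 0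
    (- x ^+ 3) (3 * x ^+ 2) (- 3 * x) 1 0 _ _) _;
    [by move=> t; ring|by move=> t; ring|by rewrite -natr1 /s; ring].
- apply: etrans (step (fun t => t ^+ 4)
    ((1 - x) ^+ 4) (4 * (1 - x) ^+ 3) (6 * (1 - x) ^+ 2) (4 * (1 - x)) 1
    (x ^+ 4) (- 4 * x ^+ 3) (6 * x ^+ 2) (- 4 * x) 1 _ _) _;
    [by move=> t; ring|by move=> t; ring|by rewrite -natr1 /s; ring].
Qed.

(** With s the standard deviation, the fourth moment is at most 3 s^4 + s^2,
    hence at most 4 s^4 when s >= 1.  Integrating a quadratic-quartic
    polynomial below |t| then gives s / 2. *)
Lemma bin_mean_abs_dev n x : 0 <= x <= 1 -> 1 <= n%:R * (x * (1 - x)) ->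
  Num.sqrt (n%:R * (x * (1 - x))) / 2 <= bin_mean n x (fun k => `|dev n x k|).
Proof.
move=> x01 v1; set v := _ * (_ * _) in v1 *; set s := Num.sqrt v.
have s_gt0 : 0 < s by rewrite sqrtr_gt0 (lt_le_trans _ v1).
have ss : s ^+ 2 = v by rewrite sqr_sqrtr// (le_trans _ v1).
have [_ M2 _ M4] := bin_mean_dev_moments n x.
(* The difference of the two sides has a double root at 2 s: that is the
   tangency giving the best constant when the fourth moment equals 4 s^4. *)
have pt k : (3 / (4 * s)) * dev n x k ^+ 2
    + (- (16 * s ^+ 3)^-1) * dev n x k ^+ 4 <= `|dev n x k|.
  set t := dev n x k.
  have [t2 t4] : `|t| ^+ 2 = t ^+ 2 /\ `|t| ^+ 4 = t ^+ 4.
    by split; rewrite -normrX ger0_norm// exprn_even_ge0.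
  rewrite -t2 -t4 -subr_ge0; set a := `|t|.
  have -> : a - (3 / (4 * s) * a ^+ 2 + - (16 * s ^+ 3)^-1 * a ^+ 4)
      = a * (a - 2 * s) ^+ 2 * (a + 4 * s) / (16 * s ^+ 3).
    by field; rewrite lt0r_neq0.
  have s0 := ltW s_gt0.
  by rewrite !(sqr_ge0, divr_ge0, mulr_ge0, addr_ge0, exprn_ge0, normr_ge0).
apply: le_trans (le_bin_mean _ _ _ _ x01 (fun k _ _ => pt k)).
rewrite bin_meanD !bin_meanZ M2 M4 -/v.
have -> : v * (1 + (3 * n%:R - 6) * (x * (1 - x)))
    = v * (1 + 3 * v - 6 * (x * (1 - x))) by rewrite /v; ring.
have xx : 0 <= x * (1 - x) by case/andP: x01 => ? ?; rewrite mulr_ge0 ?subr_ge0.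
rewrite -subr_ge0.
have -> : 3 / (4 * s) * v
    + - (16 * s ^+ 3)^-1 * (v * (1 + 3 * v - 6 * (x * (1 - x)))) - s / 2
    = (v - 1 + 6 * (x * (1 - x))) / (16 * s).
  by rewrite -ss; field; rewrite lt0r_neq0.
by rewrite divr_ge0 ?mulr_ge0 ?(ltW s_gt0)//; lra.
Qed.

(** A binomial law of variance 0 is a point mass at its mean. *)
Lemma dev_degenerate n x k : (k <= n)%N -> bin_weight n x k != 0 ->
  x * (1 - x) = 0 -> dev n x k = 0.
Proof.
rewrite /bin_weight /dev => kn w0 /eqP; rewrite mulf_eq0 => /orP[] /eqP x0.
  move: w0; rewrite x0 mulr0 subr0.
  case: k {kn} => [|k]; first by rewrite subrr.
  by rewrite expr0n/= mulr0 mul0r eqxx.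
have x1 : x = 1 by lra.
move: w0; rewrite x0 x1 expr1n mulr1 expr0n subn_eq0.
case: leqP => [nk _|_]; last by rewrite mulr0 eqxx.
by rewrite (@anti_leq k n) ?kn// mulr1 subrr.
Qed.

(** The deviation in units of the standard deviation; when the variance is 0,
    division by 0 makes it 0, which by [dev_degenerate] is the right value
    at every node that carries weight. *)
Definition zscore n x k : R := `|dev n x k| / (Num.sqrt n%:R * theta x).

Lemma zscore_ge0 n x k : 0 <= zscore n x k.
Proof. by rewrite divr_ge0 ?mulr_ge0 ?sqrtr_ge0. Qed.

Lemma sqr_scale n x : 0 <= x <= 1 ->
  (Num.sqrt n%:R * theta x) ^+ 2 = n%:R * (x * (1 - x)).
Proof.
by case/andP=> x0 x1; rewrite exprMn !sqr_sqrtr ?ler0n// mulr_ge0 ?subr_ge0.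
Qed.

(** Equality holds unless the variance is 0, where the mean is 0. *)
Lemma bin_mean_zscore2_le1 n x : 0 <= x <= 1 ->
  bin_mean n x (fun k => zscore n x k ^+ 2) <= 1.
Proof.
move=> x01; have [_ M2 _ _] := bin_mean_dev_moments n x.
rewrite (eq_bin_mean _ _ _ (fun k => (n%:R * (x * (1 - x)))^-1 * dev n x k ^+ 2)).
  rewrite bin_meanZ M2; have [->|v0] := eqVneq (n%:R * (x * (1 - x))) 0.
    by rewrite mulr0 ler01.
  by rewrite mulVf.
move=> k; rewrite /zscore expr_div_n sqr_scale// mulrC; congr (_ * _).
by rewrite -normrX ger0_norm ?sqr_ge0.
Qed.

Lemma dist_zscore n x k : (0 < n)%N -> 0 <= x <= 1 -> (k <= n)%N ->
  bin_weight n x k != 0 ->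
  `|k%:R / n%:R - x| = zscore n x k * (theta x / Num.sqrt n%:R).
Proof.
move=> n0 x01 kn w0.
have nR : 0 < n%:R :> R by rewrite ltr0n.
have s0 : Num.sqrt n%:R != 0 :> R by rewrite sqrtr_eq0 -ltNge.
have -> : k%:R / n%:R - x = dev n x k / n%:R.
  by rewrite /dev; field; rewrite lt0r_neq0.
rewrite normrM (gtr0_norm (_ : 0 < n%:R^-1)) ?invr_gt0//.
have [t0|t0] := eqVneq (theta x) 0.
  rewrite t0 mul0r mulr0 (dev_degenerate n x k) ?normr0 ?mul0r//.
  case/andP: (x01) => x0 x1.
  by rewrite -[LHS](@sqr_sqrtr R) ?mulr_ge0 ?subr_ge0// -/(theta x) t0 expr0n.
rewrite /zscore -{1}[n%:R](@sqr_sqrtr R) ?ler0n//.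
by field; rewrite t0 s0.
Qed.

Lemma bin_mean_dist_ge n x : (0 < n)%N -> 0 <= x <= 1 ->
  x * (1 - x) = 0 \/ 1 <= n%:R * (x * (1 - x)) ->
  theta x / Num.sqrt n%:R / 2 <= bin_mean n x (fun k => `|k%:R / n%:R - x|).
Proof.
move=> n0 x01 hv.
have nR : 0 < n%:R :> R by rewrite ltr0n.
have s0 : 0 < Num.sqrt n%:R :> R by rewrite sqrtr_gt0.
rewrite (eq_bin_mean _ _ _ (fun k => n%:R^-1 * `|dev n x k|)); last first.
  move=> k; rewrite -[in RHS](gtr0_norm (_ : 0 < n%:R^-1)) ?invr_gt0// -normrM.
  by congr `|_|; rewrite /dev; field; rewrite lt0r_neq0.
rewrite bin_meanZ; case: hv => hv.
  rewrite /theta hv sqrtr0 !mul0r mulr_ge0 ?invr_ge0// sumr_ge0// => k _.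
  by rewrite mulr_ge0 ?bin_weight_ge0.
rewrite ler_pdivlMl//; apply: le_trans (bin_mean_abs_dev _ _ x01 hv).
rewrite sqrtrM// -/(theta x) -{1}[n%:R](@sqr_sqrtr R) ?ler0n//.
rewrite le_eqVlt; apply/orP; left; apply/eqP.
by field; rewrite lt0r_neq0.
Qed.

Lemma bernstein2E n1 n2 (f : R * R -> R) x y :
  bernstein2 n1 n2 f x y
  = bin_mean n1 x (fun k1 => bin_mean n2 y (fun k2 =>
      f (k1%:R / n1%:R, k2%:R / n2%:R))).
Proof.
apply: eq_bigr => k1 _; rewrite mulr_sumr; apply: eq_bigr => k2 _.
by rewrite /bin_weight; ring.
Qed.

End Binomial.

(** * Integrals against the Rayleigh density *)

(** The integral of a nonnegative function is a supremum over the simple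
    functions below it, hence monotone without any measurability; the integrands
    of J contain an arbitrary modulus of continuity. *)
Lemma ge0_le_integral_nomeas (d : measure_display) (T : measurableType d)
    (R : realType) (mu : {measure set T -> \bar R}) (D : set T)
    (f g : T -> \bar R) :
  (forall x, D x -> (0 <= f x)%E) -> (forall x, D x -> (f x <= g x)%E) ->
  (\int[mu]_(x in D) f x <= \int[mu]_(x in D) g x)%E.
Proof.
move=> f0 fg.
have g0 x : D x -> (0 <= g x)%E by move=> Dx; exact: le_trans (f0 _ Dx) (fg _ Dx).
rewrite (ge0_integralE mu f0) (ge0_integralE mu g0).
apply: le_ereal_sup => _ [h /= hf <-]; exists h => //= x; apply: le_trans (hf x) _.
rewrite /patch; case: ifPn => // /set_mem; exact: fg.
Qed.

Section Rayleigh.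
Context {R : realType}.
Implicit Types (z c d A B : R).

Definition rayleigh z : R := z * expR (- (z ^+ 2 / 2)).

Lemma rayleigh_ge0 z : 0 <= z -> 0 <= rayleigh z.
Proof. by move=> z0; rewrite mulr_ge0 ?expR_ge0. Qed.

Lemma derivable_rayleigh A B z :
  derivable (fun z => (A + B * z ^+ 2) * rayleigh z : R) z 1.
Proof. by rewrite /rayleigh; apply: ex_derive. Qed.

Lemma measurable_rayleigh (D : set R) : measurable_fun D rayleigh.
Proof.
apply: measurable_funS (@subsetT _ _) _ => //.
apply: continuous_measurable_fun => z.
apply/differentiable_continuous/derivable1_diffP.
by rewrite /rayleigh; apply: ex_derive.
Qed.

(** An antiderivative of (A + B z^2) [rayleigh] z. *)
Let F A B z : R := - ((A + B * (z ^+ 2 + 2)) * expR (- (z ^+ 2 / 2))).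

Let F_derive A B z : is_derive z 1 (F A B) ((A + B * z ^+ 2) * rayleigh z).
Proof.
rewrite /F /rayleigh.
apply: is_derive_eq.
rewrite /GRing.scale /=. 
set e := expR _.
lra.
Qed.

Let F_cvgy A B : 0 <= A -> 0 <= B -> F A B z @[z --> +oo] --> 0.
Proof.
move=> A0 B0; rewrite /F -oppr0; apply: cvgN.
have lim0 : (A + 4 * B) * expR (- (z / 2) ^+ 2) @[z --> +oo] --> 0.
  rewrite -[X in _ --> X](mulr0 (A + 4 * B)); apply: cvgMr.
  apply: (@cvg_comp _ _ _ (fun z : R => z / 2) (fun z => expR (- z ^+ 2)) _
            (pinfty_nbhs R)).
    by apply: gt0_cvgMly.
  exact: cvg_gauss_fun.
apply: (squeeze_cvgr _ (cvg_cst 0) lim0).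
near=> z.
(* half of the exponent absorbs the polynomial factor: z^2 + 2 <= 4 exp(z^2/4) *)
have e_ge : 1 + z ^+ 2 / 4 <= expR (z ^+ 2 / 4) by exact: expR_ge1Dx.
have -> : expR (- (z ^+ 2 / 2)) = expR (- (z / 2) ^+ 2) * expR (- (z ^+ 2 / 4)).
  by rewrite -expRD; congr expR; field.
rewrite mulr_ge0 ?mulr_ge0 ?expR_ge0 ?addr_ge0 ?mulr_ge0 ?addr_ge0 ?sqr_ge0//=.
rewrite mulrCA mulrC ler_wpM2r ?expR_ge0// expRN ler_pdivrMr ?expR_gt0//.
have z2 := sqr_ge0 z.
set e := expR _ in e_ge *; nra.
Unshelve. all: by end_near.
Qed.

(** For (A, B) = (1, 0) this is the tail of the density, and c = 0 gives its
    moments of order 0 and 2. *)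
Lemma integral_rayleigh A B c : 0 <= A -> 0 <= B -> 0 <= c ->
  (\int[lebesgue_measure]_(z in `[c, +oo[)
     ((A + B * z ^+ 2) * rayleigh z)%:E)%E
  = ((A + B * (c ^+ 2 + 2)) * expR (- (c ^+ 2 / 2)))%:E.
Proof.
move=> A0 B0 c0.
have dF z : derivable (F A B) z 1 by [].
have cF : continuous (F A B).
  by move=> z; apply/differentiable_continuous/derivable1_diffP.
pose G (z : R) : R := (A + B * z ^+ 2) * rayleigh z.
rewrite (@ge0_continuous_FTC2y R G (F A B) c 0).
- by rewrite /F EFinN oppeK add0e.
- move=> z cz; have z0 := le_trans c0 cz.
  by rewrite mulr_ge0 ?rayleigh_ge0 ?addr_ge0 ?mulr_ge0 ?sqr_ge0.
- apply: derivable_within_continuous => z _; apply: derivable_rayleigh.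
- exact: F_cvgy.
- by [].
- exact/cvg_at_right_filter/cF.
- by move=> z _; rewrite derive1E (@derive_val _ _ _ _ _ _ _ (F_derive A B z)).
Qed.

(** The inner and the outer integral of J are both bounded below through this
    lemma: the inner one returns a two-step function again. *)
Lemma le_integral_rayleigh_steps A B c d (h : R -> \bar R) :
  0 <= A -> 0 <= B -> 0 <= c -> 0 <= d ->
  (forall z, 0 <= z ->
    (((A * (c <= z)%R%:R + B * (d <= z)%R%:R) * rayleigh z)%:E <= h z)%E) ->
  ((A * expR (- (c ^+ 2 / 2)) + B * expR (- (d ^+ 2 / 2)))%:E
    <= \int[lebesgue_measure]_(z in `[0%R, +oo[) h z)%E.
Proof.
move=> A0 B0 c0 d0 hge.
pose s a e z : \bar R := ((a * (e <= z)%R%:R) * rayleigh z)%:E.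
have s0 a e z : 0 <= a -> z \in `[0, +oo[ -> (0 <= s a e z)%E.
  rewrite in_itv/= andbT => a0 z0.
  by rewrite lee_fin mulr_ge0 ?rayleigh_ge0 ?mulr_ge0.
have ms a e (D : set R) : measurable_fun D (s a e).
  apply/measurable_EFinP; apply: measurable_funM.
    apply: measurable_funM => //.
    rewrite (_ : (fun z => (e <= z)%R%:R) = \1_`[e, +oo[%classic).
      exact: measurable_indic.
    by apply/funext => z; rewrite indicE mem_setE in_itv/= andbT.
  exact: measurable_rayleigh.
have Is a e : 0 <= a -> 0 <= e ->
    (\int[lebesgue_measure]_(z in `[0%R, +oo[) s a e z)%E
    = (a * expR (- (e ^+ 2 / 2)))%:E.
  move=> a0 e0.
  transitivity (\int[lebesgue_measure]_(z in `[e, +oo[)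
     ((a + 0 * z ^+ 2) * rayleigh z)%:E)%E; last first.
    by rewrite integral_rayleigh// mul0r addr0.
  rewrite integral_mkcond [RHS]integral_mkcond; apply: eq_integral => z _.
  rewrite /patch !mem_setE !in_itv/= !andbT /s.
  have [ez|ez] := leP e z; first by rewrite (le_trans e0 ez) mulr1 mul0r addr0.
  by rewrite mulr0 mul0r if_same.
rewrite EFinD -(Is _ _ A0 c0) -(Is _ _ B0 d0).
rewrite -ge0_integralD//; [|by move=> z zD; apply: s0|exact: ms
  |by move=> z zD; apply: s0|exact: ms].
apply: ge0_le_integral_nomeas => z; rewrite /= in_itv/= andbT => z0.
  by rewrite adde_ge0// s0// in_itv/= z0.
by rewrite /s -EFinD -mulrDl hge.
Qed.

(** The first moment is below the square root sqrt 2 of the second one: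
    integrate z <= s / 2 + z^2 / (2 s) with s = sqrt 2. *)
Lemma integral_rayleigh_le A B (h : R -> \bar R) :
  0 <= A -> 0 <= B ->
  (forall z, 0 <= z -> (0 <= h z <= ((A + B * z) * rayleigh z)%:E)%E) ->
  (\int[lebesgue_measure]_(z in `[0%R, +oo[) h z
    <= (A + B * Num.sqrt 2)%:E)%E.
Proof.
move=> A0 B0 hle; set s := Num.sqrt 2.
have s_gt0 : 0 < s by rewrite sqrtr_gt0.
have ss : s ^+ 2 = 2 by rewrite sqr_sqrtr.
have -> : (A + B * s)%:E = (((A + B * (s / 2)) + B / (2 * s) * (0 ^+ 2 + 2))
    * expR (- (0 ^+ 2 / 2)))%:E.
  rewrite expr0n/= mul0r oppr0 expR0 mulr1 add0r; congr EFin.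
  rewrite -addrA -mulrA -mulrDr; congr (_ + B * _).
  apply: (mulIf (lt0r_neq0 s_gt0)).
  by rewrite -expr2 ss mulrDl mulrAC -expr2 ss; field; rewrite lt0r_neq0.
rewrite -integral_rayleigh// ?addr_ge0 ?mulr_ge0 ?invr_ge0 ?mulr_ge0 ?(ltW s_gt0)//.
apply: ge0_le_integral_nomeas => z; rewrite /= in_itv/= andbT => z0.
  by have /andP[] := hle z z0.
have /andP[_ /le_trans] := hle z z0; apply.
rewrite lee_fin ler_wpM2r ?rayleigh_ge0// -addrA lerD2l -mulrA -mulrDr ler_wpM2l//.
rewrite -subr_ge0.
have -> : s / 2 + (2 * s)^-1 * z ^+ 2 - z = (2 * s)^-1 * (s - z) ^+ 2.
  by field; rewrite lt0r_neq0.
by rewrite mulr_ge0 ?sqr_ge0// invr_ge0 mulr_ge0 ?(ltW s_gt0).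
Qed.

End Rayleigh.

Lemma sin_le_id {R : realType} (t : R) : 0 <= t -> sin t <= t.
Proof.
rewrite le_eqVlt => /predU1P[<-|t0]; first by rewrite sin0.
have [c _] : exists2 c, c \in `]0, t[ & sin t - sin 0 = cos c * (t - 0).
  apply: MVT => //; apply: derivable_within_continuous => u _; exact: ex_derive.
rewrite sin0 !subr0 => ->.
by rewrite -[leRHS]mul1r ler_wpM2r ?(ltW t0)// cos_le1.
Qed.

(** Since sin(pi / 4)^2 = 1 / 2, the inequality sin t <= t at t = pi / 4 squares
    to 1 / 2 <= pi^2 / 16. *)
Lemma sqrt2_le_pihalf {R : realType} : Num.sqrt 2 <= pi / 2 :> R.
Proof.
have pi0 := pi_ge0 R.
have sq : sin (pi / 4) ^+ 2 = 2^-1 :> R.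
  have := cos_pihalf R.
  rewrite (_ : pi / 2 = (pi / 4) *+ 2); last by rewrite -mulr_natr; field.
  by rewrite cos_mulr2n sin2cos2 -mulr_natr => h; lra.
have le := @sin_le_id R (pi / 4).
have s0 : 0 <= sin (pi / 4) :> R by apply: sin_ge0_pi; lra.
rewrite -[leRHS]ger0_norm ?divr_ge0// -sqrtr_sqr ler_sqrt ?sqr_ge0//.
by move: (sin _) sq s0 le => s sq s0 le; nra.
Qed.

(** * The modulus of continuity and the upper estimate of the error *)

Section Modulus.
Context {R : realType}.
Implicit Types (f : R * R -> R) (p q : R * R) (d e c x y : R).

(** Needed for every supremum defining the modulus to be that of a bounded set. *)
Lemma continuous_on_square_bounded f : continuous_on_square f ->
  exists M, forall p, unit_square p -> `|f p| <= M.
Proof.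
move=> cf.
have cS : compact (@unit_square R).
  by apply: compact_setX; exact: segment_compact.
have [M [_ HM]] := compact_bounded (continuous_compact cf cS).
exists (M + 1) => p Sp; apply: (HM (M + 1)); first by rewrite ltrDl.
by exists p.
Qed.

Lemma le_modulus_of f d1 d2 p q : continuous_on_square f ->
  unit_square p -> unit_square q ->
  `|p.1 - q.1| <= d1 -> `|p.2 - q.2| <= d2 -> `|f p - f q| <= modulus f d1 d2.
Proof.
move=> cf Sp Sq h1 h2; have [M HM] := continuous_on_square_bounded _ cf.
apply: ub_le_sup; last by exists p, q.
exists (M + M) => _ [p' [q' [Sp' Sq' _ _ ->]]].
by rewrite (le_trans (ler_normB _ _))// lerD// HM.
Qed.

Lemma modulus_le f d1 d2 M : 0 <= d1 -> 0 <= d2 ->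
  (forall p q, unit_square p -> unit_square q ->
    `|p.1 - q.1| <= d1 -> `|p.2 - q.2| <= d2 -> `|f p - f q| <= M) ->
  modulus f d1 d2 <= M.
Proof.
move=> d10 d20 H; apply: ge_sup; last by move=> _ [p [q [? ? ? ? ->]]]; exact: H.
have S0 : unit_square (0 : R, 0 : R) by split; rewrite /= in_itv/= lexx ler01.
by exists 0, (0, 0), (0, 0); rewrite !subrr normr0.
Qed.

Lemma modulus_ge0 f d1 d2 : continuous_on_square f -> 0 <= d1 -> 0 <= d2 ->
  0 <= modulus f d1 d2.
Proof.
move=> cf d10 d20.
have S0 : unit_square (0 : R, 0 : R) by split; rewrite /= in_itv/= lexx ler01.
have := le_modulus_of f d1 d2 (0, 0) (0, 0) cf S0 S0.
by rewrite !subrr !normr0; apply.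
Qed.

Lemma le_modulus f d1 d2 e1 e2 : continuous_on_square f ->
  0 <= d1 -> 0 <= d2 -> d1 <= e1 -> d2 <= e2 ->
  modulus f d1 d2 <= modulus f e1 e2.
Proof.
move=> cf d10 d20 h1 h2; apply: modulus_le => // p q Sp Sq a1 a2.
by apply: le_modulus_of => //; [exact: le_trans h1|exact: le_trans h2].
Qed.

Lemma unit_square_conv p q t : unit_square p -> unit_square q -> 0 <= t <= 1 ->
  unit_square (q.1 + t * (p.1 - q.1), q.2 + t * (p.2 - q.2)).
Proof.
rewrite /unit_square /= !in_itv /= => -[/andP[? ?] /andP[? ?]].
by move=> [/andP[? ?] /andP[? ?]] /andP[? ?]; split; apply/andP; split; nra.
Qed.

(** The segment from q to p is cut into equal pieces, which stay in the square
    by convexity. *)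
Lemma le_modulus_chain f d1 d2 p q (m : nat) : continuous_on_square f ->
  unit_square p -> unit_square q ->
  `|p.1 - q.1| <= m.+1%:R * d1 -> `|p.2 - q.2| <= m.+1%:R * d2 ->
  `|f p - f q| <= m.+1%:R * modulus f d1 d2.
Proof.
move=> cf Sp Sq h1 h2; have m0 : 0 < m.+1%:R :> R by [].
pose pt (i : nat) : R * R :=
  (q.1 + i%:R / m.+1%:R * (p.1 - q.1), q.2 + i%:R / m.+1%:R * (p.2 - q.2)).
have Spt i : (i <= m.+1)%N -> unit_square (pt i).
  move=> im; apply: unit_square_conv => //.
  by rewrite divr_ge0//= ler_pdivrMr// mul1r ler_nat.
have pt0 : pt 0%N = q by rewrite /pt !mul0r !addr0 -surjective_pairing.
have ptm : pt m.+1 = p.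
  have addKsub (u v : R) : v + (u - v) = u by ring.
  by rewrite /pt divff// !mul1r !addKsub -surjective_pairing.
have -> : f p - f q = \sum_(0 <= i < m.+1) (f (pt i.+1) - f (pt i)).
  by rewrite telescope_sumr// pt0 ptm.
rewrite (le_trans (ler_norm_sum _ _ _))// mulr_natl -[X in _ *+ X]subn0.
rewrite -sumr_const_nat; apply: ler_sum_nat => i /= im.
have step (u v d : R) : `|u - v| <= m.+1%:R * d ->
    `|v + i.+1%:R / m.+1%:R * (u - v) - (v + i%:R / m.+1%:R * (u - v))| <= d.
  have -> : v + i.+1%:R / m.+1%:R * (u - v) - (v + i%:R / m.+1%:R * (u - v))
     = (u - v) / m.+1%:R by rewrite -[i.+1%:R]natr1; field; rewrite lt0r_neq0.
  by move=> h; rewrite normrM normfV (gtr0_norm m0) ler_pdivrMr// mulrC.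
by apply: le_modulus_of => //; [exact: Spt|exact/Spt/ltnW|exact: step|exact: step].
Qed.

(** The affine function of t whose value at t = k^2 is k + 1 for both k = j and
    k = j + 1.  A larger j suits a larger second moment. *)
Definition stair_bound (j : nat) (t : R) : R :=
  1 + (j%:R * (j%:R + 1) + t) / (j%:R *+ 2 + 1).

(** At m^2 the excess of the bound over m + 1 is (m - j) (m - j - 1) / (2 j + 1),
    and two consecutive integers never have opposite signs. *)
Lemma stair_bound_ge (j : nat) (t : R) : 0 <= t ->
  (Num.truncn t).+1%:R <= stair_bound j (t ^+ 2).
Proof.
move=> t0; have /andP[mt _] := truncn_itv t0; set m := Num.truncn t in mt *.
have j0 : 0 <= j%:R :> R by [].
have m0 : 0 <= m%:R :> R by [].
have mj : 0 <= (m%:R - j%:R) * (m%:R - j%:R - 1) :> R.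
  have [le|] := leqP m j.
    have ? : m%:R <= j%:R :> R by rewrite ler_nat.
    by rewrite mulr_le0//; lra.
  by rewrite -(ler_nat R) -natr1 => ?; rewrite mulr_ge0//; lra.
have mt2 : m%:R ^+ 2 <= t ^+ 2 by rewrite ler_pXn2r// nnegrE.
have q0 : 0 < j%:R *+ 2 + 1 :> R by rewrite ltr_wpDl// mulrn_wge0.
rewrite /stair_bound -natr1 addrC lerD2l ler_pdivlMr// -subr_ge0.
have -> : j%:R * (j%:R + 1) + t ^+ 2 - m%:R * (j%:R *+ 2 + 1)
    = (m%:R - j%:R) * (m%:R - j%:R - 1) + (t ^+ 2 - m%:R ^+ 2) by ring.
by rewrite addr_ge0// subr_ge0.
Qed.

Lemma osc_le_modulus f d1 d2 c (j : nat) p q a b :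
  continuous_on_square f -> unit_square p -> unit_square q ->
  0 < c -> 0 <= d1 -> 0 <= d2 -> 0 <= a -> 0 <= b ->
  `|p.1 - q.1| <= a * d1 -> `|p.2 - q.2| <= b * d2 ->
  `|f p - f q|
    <= stair_bound j ((a ^+ 2 + b ^+ 2) / c ^+ 2) * modulus f (c * d1) (c * d2).
Proof.
move=> cf Sp Sq c0 d10 d20 a0 b0 h1 h2.
have c0' := ltW c0.
pose t := Num.max a b / c.
have t0 : 0 <= t by rewrite divr_ge0// le_max a0.
have at_ : a <= t * c by rewrite divfK ?lt0r_neq0// le_max lexx.
have bt_ : b <= t * c by rewrite divfK ?lt0r_neq0// le_max lexx orbT.
have tm : t <= (Num.truncn t).+1%:R by rewrite ltW// truncnS_gt.
apply: (le_trans (le_modulus_chain f (c * d1) (c * d2) p q (Num.truncn t) cf Sp Sq _ _)).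
- by rewrite (le_trans h1)// mulrA ler_wpM2r// (le_trans at_)// ler_wpM2r.
- by rewrite (le_trans h2)// mulrA ler_wpM2r// (le_trans bt_)// ler_wpM2r.
apply: ler_wpM2r; first by rewrite modulus_ge0 ?mulr_ge0.
apply: (le_trans (stair_bound_ge j t t0)).
rewrite /stair_bound lerD2l ler_wpM2r ?invr_ge0 ?addr_ge0 ?mulrn_wge0//.
rewrite lerD2l /t expr_div_n ler_wpM2r ?invr_ge0 ?sqr_ge0//.
by rewrite /Num.max; case: ifP => _; rewrite ?lerDl ?lerDr sqr_ge0.
Qed.

Lemma node_in_itv (n k : nat) : (k <= n)%N -> k%:R / n%:R \in `[0 : R, 1].
Proof.
move=> kn; rewrite in_itv/= divr_ge0//=.
have [->|n0] := posnP n; first by rewrite invr0 mulr0.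
by rewrite ler_pdivrMr ?ltr0n// mul1r ler_nat.
Qed.

(** [osc_le_modulus] at the nodes, averaged: the squared standardised deviations
    have mean at most 1 in each variable, which turns a^2 + b^2 into 2. *)
Lemma Delta_le_modulus f c (j : nat) n1 n2 x y :
  continuous_on_square f -> 0 < c -> (0 < n1)%N -> (0 < n2)%N ->
  0 <= x <= 1 -> 0 <= y <= 1 ->
  Delta n1 n2 f x y <= stair_bound j (2 / c ^+ 2)
    * modulus f (c * (theta x / Num.sqrt n1%:R)) (c * (theta y / Num.sqrt n2%:R)).
Proof.
move=> cf c0 n10 n20 x01 y01.
set d1 := theta x / _; set d2 := theta y / _.
have d10 : 0 <= d1 by rewrite divr_ge0 ?sqrtr_ge0.
have d20 : 0 <= d2 by rewrite divr_ge0 ?sqrtr_ge0.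
set om := modulus _ _ _.
have om0 : 0 <= om by apply: modulus_ge0; rewrite // mulr_ge0// ltW.
pose A : R := stair_bound j 0 * om.
pose B : R := om / (j%:R *+ 2 + 1) / c ^+ 2.
have j0 : 0 < j%:R *+ 2 + 1 :> R by rewrite ltr_wpDl// mulrn_wge0.
have stE t : stair_bound j (t / c ^+ 2) * om = A + B * t.
  by rewrite /A /B /stair_bound; field; rewrite !lt0r_neq0.
have B0 : 0 <= B by rewrite !divr_ge0 ?sqr_ge0// ltW.
rewrite stE.
have -> : Delta n1 n2 f x y = `|bin_mean n1 x (fun k1 => bin_mean n2 y (fun k2 =>
    f (k1%:R / n1%:R, k2%:R / n2%:R) - f (x, y)))|.
  rewrite /Delta bernstein2E; congr `|_|.
  rewrite (eq_bin_mean n1 x (fun k1 => bin_mean n2 y (fun k2 =>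
    f (k1%:R / n1%:R, k2%:R / n2%:R) - f (x, y))) (fun k1 => bin_mean n2 y (fun k2 =>
    f (k1%:R / n1%:R, k2%:R / n2%:R)) + - f (x, y))).
    by rewrite bin_meanD bin_mean_cst.
  by move=> k1; rewrite bin_meanD bin_mean_cst.
apply: le_trans (ler_norm_bin_mean _ _ _ x01) _.
have inner k1 : (k1 <= n1)%N -> bin_weight n1 x k1 != 0 ->
    `|bin_mean n2 y (fun k2 => f (k1%:R / n1%:R, k2%:R / n2%:R) - f (x, y))|
    <= (A + B) + B * zscore n1 x k1 ^+ 2.
  move=> k1n w1; apply: le_trans (ler_norm_bin_mean _ _ _ y01) _.
  apply: (@le_trans _ _ (bin_mean n2 y (fun k2 =>
      (A + B * zscore n1 x k1 ^+ 2) + B * zscore n2 y k2 ^+ 2))).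
    apply: le_bin_mean => // k2 k2n w2; rewrite -addrA -mulrDr -stE.
    apply: osc_le_modulus => //; rewrite ?zscore_ge0//=.
    - by split; rewrite /=; exact: node_in_itv.
    - by rewrite dist_zscore// -/d1.
    - by rewrite dist_zscore// -/d2.
  rewrite bin_meanD bin_mean_cst bin_meanZ.
  have := ler_wpM2l B0 (bin_mean_zscore2_le1 n2 y y01); lra.
apply: (le_trans (le_bin_mean _ _ _ _ x01 inner)).
rewrite bin_meanD bin_mean_cst bin_meanZ (_ : A + B * 2 = A + B + B * 1); last by ring.
by rewrite lerD2l ler_wpM2l// bin_mean_zscore2_le1.
Qed.

End Modulus.

(** * Bounds on J *)

Section J_bounds.
Context {R : realType}.
Implicit Types (f : R * R -> R) (x y z c : R).

Let integrandE f (a b z1 z2 : R) :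
  modulus f a b * z1 * z2 * expR (- (z1 ^+ 2 / 2) - z2 ^+ 2 / 2)
  = modulus f a b * rayleigh z2 * rayleigh z1.
Proof. by rewrite expRD /rayleigh; ring. Qed.

Lemma J_ge0 n1 n2 f x y : continuous_on_square f -> (0 <= J n1 n2 f x y)%E.
Proof.
move=> cf; apply: integral_ge0 => z2; rewrite /= in_itv/= andbT => z20.
apply: integral_ge0 => z1; rewrite /= in_itv/= andbT => z10.
rewrite lee_fin integrandE !mulr_ge0 ?rayleigh_ge0//.
by rewrite modulus_ge0// !mulr_ge0 ?invr_ge0 ?sqrtr_ge0.
Qed.

(** By monotonicity the modulus at (z1 d1, z2 d2) dominates the function that is
    m1 on the quadrant z1, z2 >= c1 plus m2 on the quadrant z1, z2 >= c2. *)
Lemma J_ge_steps n1 n2 f x y c1 c2 m1 m2 : continuous_on_square f ->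
  0 <= c1 -> 0 <= c2 -> 0 <= m1 -> 0 <= m2 ->
  m1 <= modulus f (c1 * (theta x / Num.sqrt n1%:R))
                  (c1 * (theta y / Num.sqrt n2%:R)) ->
  m1 + m2 <= modulus f (c2 * (theta x / Num.sqrt n1%:R))
                       (c2 * (theta y / Num.sqrt n2%:R)) ->
  ((m1 * expR (- c1 ^+ 2) + m2 * expR (- c2 ^+ 2))%:E <= J n1 n2 f x y)%E.
Proof.
move=> cf c10 c20 m10 m20; set d1 := theta x / _; set d2 := theta y / _ => h1 h2.
have d10 : 0 <= d1 by rewrite divr_ge0 ?sqrtr_ge0.
have d20 : 0 <= d2 by rewrite divr_ge0 ?sqrtr_ge0.
have expR2 c : expR (- c ^+ 2) = expR (- (c ^+ 2 / 2)) * expR (- (c ^+ 2 / 2)).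
  by rewrite -expRD; congr expR; field.
rewrite !expR2 !mulrA.
have mono c z1 z2 : 0 <= c -> c <= z1 -> c <= z2 ->
    modulus f (c * d1) (c * d2)
    <= modulus f (z1 * theta x / Num.sqrt n1%:R) (z2 * theta y / Num.sqrt n2%:R).
  move=> c0 cz1 cz2; rewrite -!mulrA -/d1 -/d2.
  by apply: le_modulus => //; [exact: mulr_ge0|exact: mulr_ge0
    |exact: ler_wpM2r|exact: ler_wpM2r].
apply: le_integral_rayleigh_steps; rewrite // ?mulr_ge0 ?expR_ge0// => z2 z20.
have r20 := rayleigh_ge0 z2 z20.
apply: (@le_trans _ _ (m1 * (c1 <= z2)%R%:R * rayleigh z2 * expR (- (c1 ^+ 2 / 2))
  + m2 * (c2 <= z2)%R%:R * rayleigh z2 * expR (- (c2 ^+ 2 / 2)))%:E).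
  by rewrite lee_fin le_eqVlt; apply/orP; left; apply/eqP; ring.
apply: le_integral_rayleigh_steps; rewrite // ?mulr_ge0// => z1 z10.
rewrite lee_fin integrandE ler_wpM2r ?rayleigh_ge0//.
rewrite ![_ * rayleigh z2 * _%:R]mulrAC -mulrDl ler_wpM2r//.
have om0 : 0 <= modulus f (z1 * theta x / Num.sqrt n1%:R)
    (z2 * theta y / Num.sqrt n2%:R).
  by rewrite modulus_ge0// !mulr_ge0 ?invr_ge0 ?sqrtr_ge0.
have [a1|a1] := leP c1 z1; have [b1|b1] := leP c1 z2;
  have [a2|a2] := leP c2 z1; have [b2|b2] := leP c2 z2;
  rewrite ?(mulr0, mulr1, addr0, add0r)//;
  try by apply: le_trans h1 (mono _ _ _ c10 a1 b1).
all: try by apply: le_trans h2 (mono _ _ _ c20 a2 b2).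
all: by apply: le_trans (mono _ _ _ c20 a2 b2); apply: le_trans h2; rewrite lerDr.
Qed.

Lemma J_le n1 n2 f x y : continuous_on_square f ->
  (forall d1 d2, 0 <= d1 -> 0 <= d2 -> modulus f d1 d2 <= d1 + d2) ->
  (J n1 n2 f x y <= ((theta x / Num.sqrt n1%:R + theta y / Num.sqrt n2%:R)
                      * Num.sqrt 2)%:E)%E.
Proof.
move=> cf flip; set d1 := theta x / _; set d2 := theta y / _.
have d10 : 0 <= d1 by rewrite divr_ge0 ?sqrtr_ge0.
have d20 : 0 <= d2 by rewrite divr_ge0 ?sqrtr_ge0.
have K0 : 0 <= Num.sqrt 2 :> R by rewrite sqrtr_ge0.
have om0 z1 z2 : 0 <= z1 -> 0 <= z2 ->
    0 <= modulus f (z1 * theta x / Num.sqrt n1%:R)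
                   (z2 * theta y / Num.sqrt n2%:R).
  by move=> z10 z20; rewrite modulus_ge0// !mulr_ge0 ?invr_ge0 ?sqrtr_ge0.
rewrite mulrDl; apply: integral_rayleigh_le => //.
  by rewrite mulr_ge0.
move=> z2 z20; have r20 := rayleigh_ge0 z2 z20; apply/andP; split.
  apply: integral_ge0 => z1; rewrite /= in_itv/= andbT => z10.
  by rewrite lee_fin integrandE !mulr_ge0 ?rayleigh_ge0// om0.
have -> : (d1 * Num.sqrt 2 + d2 * z2) * rayleigh z2
    = d2 * z2 * rayleigh z2 + d1 * rayleigh z2 * Num.sqrt 2 by ring.
apply: integral_rayleigh_le => [||z1 z10]; [|exact: mulr_ge0|].
  by apply: mulr_ge0 => //; exact: mulr_ge0.
have r10 := rayleigh_ge0 z1 z10.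
rewrite !lee_fin integrandE !mulr_ge0 ?om0//= ler_wpM2r//.
have -> : d2 * z2 * rayleigh z2 + d1 * rayleigh z2 * z1
    = (z1 * d1 + z2 * d2) * rayleigh z2 by ring.
by rewrite ler_wpM2r// -!mulrA -/d1 -/d2 flip//; exact: mulr_ge0.
Qed.

End J_bounds.

(** Two steps, at c = 1/2 and c = 1, where [stair_bound] is 19/5 and 7/3; a
    single step does not reach the constant 4.  The increment 22/133 is
    3/7 - 5/19, and exp(-1/8) >= 7/8 is accurate enough for both weights. *)
Lemma Delta_le_J (R : realType) n1 n2 (f : R * R -> R) (x y : R) :
  continuous_on_square f -> (0 < n1)%N -> (0 < n2)%N ->
  0 <= x <= 1 -> 0 <= y <= 1 ->
  ((Delta n1 n2 f x y / 4)%:E <= J n1 n2 f x y)%E.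
Proof.
move=> cf n10 n20 x01 y01; set D := Delta _ _ _ _ _.
have D0 : 0 <= D by exact: normr_ge0.
have h1 := @Delta_le_modulus R f 1 1 n1 n2 x y cf ltr01 n10 n20 x01 y01.
have c0 : 0 < 2^-1 :> R by rewrite invr_gt0.
have h2 := @Delta_le_modulus R f 2^-1 2 n1 n2 x y cf c0 n10 n20 x01 y01.
have s1 : stair_bound 1 (2 / 1 ^+ 2) = 7 / 3 :> R by rewrite /stair_bound; field.
have s2 : stair_bound 2 (2 / 2^-1 ^+ 2) = 19 / 5 :> R by rewrite /stair_bound; field.
rewrite s1 -/D in h1; rewrite s2 -/D in h2.
have J1 := @J_ge_steps R n1 n2 f x y 2^-1 1 (5 / 19 * D) (22 / 133 * D) cf
  (ltW c0) ler01.
apply: (le_trans _ (J1 _ _ _ _)); [|by rewrite mulr_ge0|by rewrite mulr_ge0|lra|lra].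
rewrite lee_fin.
have u : 7 / 8 <= expR (- 8^-1) :> R.
  by apply: le_trans (expR_ge1Dx _); lra.
have -> : expR (- 2^-1 ^+ 2) = expR (- 8^-1) ^+ 2 :> R.
  by rewrite -expRM_natl; congr expR; field.
have -> : expR (- 1 ^+ 2) = expR (- 8^-1) ^+ 8 :> R.
  by rewrite -expRM_natl; congr expR; field.
have uX n : (7 / 8) ^+ n <= expR (- 8^-1) ^+ n :> R.
  by apply: lerXn2r u; rewrite nnegrE ?expR_ge0// divr_ge0.
apply: (@le_trans _ _ (5 / 19 * D * (7 / 8) ^+ 2 + 22 / 133 * D * (7 / 8) ^+ 8)).
  2: by apply: lerD; rewrite ler_wpM2l ?mulr_ge0.
have -> : 5 / 19 * D * (7 / 8) ^+ 2 + 22 / 133 * D * (7 / 8) ^+ 8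
   = (5 / 19 * (7 / 8) ^+ 2 + 22 / 133 * (7 / 8) ^+ 8) * D by ring.
rewrite mulrC ler_wpM2r//; lra.
Qed.

(** * A function for the lower bound *)

Section Witness.
Context {R : realType}.
Implicit Types x y : R.

Definition l1_dist x y (p : R * R) : R := `|p.1 - x| + `|p.2 - y|.

Lemma continuous_l1_dist x y : continuous_on_square (l1_dist x y).
Proof.
apply: continuous_subspaceT => p.
have h1 : (fun q : R * R => `|q.1 - x|) q @[q --> p] --> `|p.1 - x|.
  by apply: cvg_norm; apply: cvgB; [exact: cvg_fst|exact: cvg_cst].
have h2 : (fun q : R * R => `|q.2 - y|) q @[q --> p] --> `|p.2 - y|.
  by apply: cvg_norm; apply: cvgB; [exact: cvg_snd|exact: cvg_cst].
exact: cvgD h1 h2.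
Qed.

Lemma modulus_l1_dist x y d1 d2 : 0 <= d1 -> 0 <= d2 ->
  modulus (l1_dist x y) d1 d2 <= d1 + d2.
Proof.
move=> d10 d20; apply: modulus_le => // p q _ _ h1 h2; rewrite /l1_dist.
have -> : `|p.1 - x| + `|p.2 - y| - (`|q.1 - x| + `|q.2 - y|)
  = (`|p.1 - x| - `|q.1 - x|) + (`|p.2 - y| - `|q.2 - y|) by ring.
apply: le_trans (ler_normD _ _) _; apply: lerD.
  apply: le_trans (ler_dist_dist _ _) _.
  by rewrite opprB addrA subrK.
apply: le_trans (ler_dist_dist _ _) _.
by rewrite opprB addrA subrK.
Qed.

Lemma l1_dist_nonconstant x y : 0 <= x <= 1 -> 0 <= y <= 1 ->
  ~ constant_on_square (l1_dist x y).
Proof.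
move=> x01 y01 [c H].
have cx (u : R) : 0 <= u <= 1 -> `|u - x| = c.
  move=> u01; rewrite -(H (u, y)); last by split; rewrite /= in_itv.
  by rewrite /l1_dist /= subrr normr0 addr0.
have c0 : c = 0 by rewrite -(cx x x01) subrr normr0.
have x0 : 0 - x = 0 by apply/normr0_eq0; rewrite cx ?lexx ?ler01.
have x1 : 1 - x = 0 by apply/normr0_eq0; rewrite cx ?lexx ?ler01.
lra.
Qed.

Lemma Delta_l1_dist n1 n2 x y : 0 <= x <= 1 -> 0 <= y <= 1 ->
  Delta n1 n2 (l1_dist x y) x y
  = bin_mean n1 x (fun k => `|k%:R / n1%:R - x|)
    + bin_mean n2 y (fun k => `|k%:R / n2%:R - y|).
Proof.
move=> x01 y01; rewrite /Delta bernstein2E /l1_dist /= !subrr !normr0 addr0 subr0.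
rewrite (eq_bin_mean _ _ _ (fun k1 => `|k1%:R / n1%:R - x|
   + bin_mean n2 y (fun k => `|k%:R / n2%:R - y|))); last first.
  by move=> k1; rewrite bin_meanD bin_mean_cst.
rewrite bin_meanD bin_mean_cst ger0_norm// addr_ge0// sumr_ge0// => k _;
  by rewrite mulr_ge0 ?bin_weight_ge0.
Qed.

(** Any degree making the variance at least 1 will do; if the variance is 0 for
    every degree, the left-hand side is 0. *)
Lemma exists_good_degree x : 0 <= x <= 1 -> exists2 n, (0 < n)%N &
  theta x / Num.sqrt n%:R / 2 <= bin_mean n x (fun k => `|k%:R / n%:R - x|).
Proof.
move=> x01; have [v0|v0] := eqVneq (x * (1 - x)) 0.
  by exists 1%N => //; apply: bin_mean_dist_ge => //; left.
have v_gt0 : 0 < x * (1 - x).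
  by case/andP: x01 => ? ?; rewrite lt_neqAle eq_sym v0 mulr_ge0 ?subr_ge0.
exists (Num.truncn (x * (1 - x))^-1).+1 => //; apply: bin_mean_dist_ge => //; right.
by rewrite -ler_pdivrMr// mul1r ltW// truncnS_gt.
Qed.

Lemma theta_gt0 x : 0 <= x <= 1 -> x <> 0 -> x <> 1 -> 0 < theta x.
Proof.
move=> /andP[x0 x1] /eqP n0 /eqP n1.
by rewrite sqrtr_gt0 mulr_gt0 ?subr_gt0 ?lt_neqAle ?x0 ?x1 ?n1 1?eq_sym ?n0.
Qed.

End Witness.

(** * Quotients of extended reals and the theorem *)

(** At I = 0 the hypothesis forces D = 0, and the quotient 0 / 0 is 0. *)
Lemma lee_div_of_le (R : realType) (D c : R) (I : \bar R) : 0 <= D -> 0 < c ->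
  ((D / c)%:E <= I)%E -> (D%:E / I <= c%:E)%E.
Proof.
move=> D0 c0; case: I => [r| |]; last by rewrite leeNy_eq.
- rewrite lee_fin ler_pdivrMr// => h.
  have [r0|r0] := eqVneq r 0.
    have -> : D = 0 by apply/le_anti; rewrite D0 andbT (le_trans h)// r0 mul0r.
    by rewrite mul0e lee_fin ltW.
  have r_gt0 : 0 < r.
    by rewrite lt_neqAle eq_sym r0 -(pmulr_lge0 _ c0) (le_trans D0).
  by rewrite inver (negbTE r0) -EFinM lee_fin ler_pdivrMr// mulrC.
- by move=> _; rewrite invey mule0 lee_fin ltW.
Qed.

(** At I = 0 the quotient is +oo because D > 0. *)
Lemma le_lee_div (R : realType) (D c : R) (I : \bar R) : 0 < D -> 0 < c ->
  (0 <= I)%E -> (I <= (D / c)%:E)%E -> (c%:E <= D%:E / I)%E.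
Proof.
move=> D0 c0; case: I => [r| |]//; rewrite !lee_fin => r0 h.
rewrite inver; case: ifPn => [_|rn0]; first by rewrite gt0_muley ?leey// lte_fin.
have r_gt0 : 0 < r by rewrite lt_neqAle eq_sym rn0.
by rewrite -EFinM lee_fin ler_pdivlMr// mulrC -ler_pdivlMr.
Qed.

Theorem theorem5p1 (R : realType) (x y : R)
    (hx : 0 <= x <= 1) (hy : 0 <= y <= 1) :
  (~ square_vertex x y -> ((pi^-1)%:E <= W2 x y)%E) /\
  (W2 x y <= (2 ^+ 2)%:E)%E.
Proof.
split=> [nv|]; last first.
  apply: ge_ereal_sup => _ [f [cf _] <-].
  apply: ge_ereal_sup => _ [[n1 n2] [/= n10 n20] <-].
  have -> : 2 ^+ 2 = 4 :> R by rewrite -natrX.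
  by apply: lee_div_of_le; [exact: normr_ge0|exact: ltr0n|exact: Delta_le_J].
have [n1 n10 E1] := exists_good_degree x hx.
have [n2 n20 E2] := exists_good_degree y hy.
have cf := continuous_l1_dist x y.
set D := Delta n1 n2 (l1_dist x y) x y.
set d := theta x / Num.sqrt n1%:R + theta y / Num.sqrt n2%:R.
have D_ge : d / 2 <= D.
  by rewrite /D Delta_l1_dist// /d mulrDl; apply: lerD.
have t0 n (z : R) : (0 < n)%N -> 0 <= z <= 1 ->
    (z = 0 \/ z = 1) \/ 0 < theta z / Num.sqrt n%:R.
  move=> n0 z01; have [->|z0] := eqVneq z 0; first by left; left.
  have [->|z1] := eqVneq z 1; first by left; right.
  right; rewrite divr_gt0 ?theta_gt0 ?sqrtr_gt0 ?ltr0n//; exact/eqP.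
have d_gt0 : 0 < d.
  case: (t0 n1 x n10 hx) => [xv|xp]; last first.
    by rewrite /d ltr_wpDr// divr_ge0 ?sqrtr_ge0.
  case: (t0 n2 y n20 hy) => [yv|yp]; last first.
    by rewrite /d ltr_wpDl// divr_ge0 ?sqrtr_ge0.
  by case: nv.
(* J <= d sqrt 2 <= d (pi / 2) <= pi D *)
have J_D : (J n1 n2 (l1_dist x y) x y <= (D / pi^-1)%:E)%E.
  apply: le_trans (J_le n1 n2 _ x y cf (modulus_l1_dist x y)) _.
  rewrite -/d lee_fin invrK.
  have := ler_wpM2l (ltW d_gt0) (@sqrt2_le_pihalf R).
  have := ler_wpM2r (pi_ge0 R) D_ge.
  lra.
apply: (@le_trans _ _ (D%:E / J n1 n2 (l1_dist x y) x y)%E).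
  apply: le_lee_div J_D; rewrite ?invr_gt0 ?pi_gt0 ?J_ge0//.
  by apply: lt_le_trans D_ge; rewrite divr_gt0.
apply: (@le_trans _ _ (ereal_sup [set ((Delta n.1 n.2 (l1_dist x y) x y)%:E
    / J n.1 n.2 (l1_dist x y) x y)%E
    | n in [set n : nat * nat | (0 < n.1)%N /\ (0 < n.2)%N] ])).
  by apply: ereal_sup_ubound; exists (n1, n2).
apply: ereal_sup_ubound; exists (l1_dist x y) => //; split => //.
exact: l1_dist_nonconstant.
Qed.
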